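(* Let $n\in\{2,3\}$ and let $M=(\alpha_{i,j})_{1\leqslant i,j\leqslant 2}$ be a Griffiths positive $2\times 2$ matrix of constant coefficient $(1,1)$-forms on $\mathbb{C}^n$. Let $\Omega=\det(M)\in V^{2,2}$. Then for every Kähler form $\omega\in V^{1,1}$ and every bidegree $(p,q)$ with $p,q\geqslant 0$, $p+q=n-2$, the form $\Omega$ satisfies HLT, HRR and LD for the bidegree $(p,q)$ (with respect to $\omega$).
   Context: Let $V=(\mathbb{C}^n)^*$ with complex linear coordinates $(z_1,\dots,z_n)$, and let $V^{p,q}=\Lambda^pV\otimes\Lambda^q\overline{V}$ be the space of constant coefficient $(p,q)$-forms on $\mathbb{C}^n$ (with $V^{p,q}=0$ unless $0\leqslant p,q\leqslant n$). A form $\omega\in V^{1,1}$ is Kähler if $\omega=\sum_{l=1}^n\frac{\sqrt{-1}}{2}dw_l\wedge d\overline{w_l}$ in some complex linear coordinates $(w_1,\dots,w_n)$ (equivalently, its coefficient matrix is Hermitian positive definite). A $k\times k$ matrix $M=(\alpha_{i,j})$ with entries in $V^{1,1}$ is Hermitian if $\alpha_{i,j}=\overline{\alpha_{j,i}}$; a Hermitian $M$ is Griffiths positive if for every $\theta\in\mathbb{C}^k\setminus\{0\}$ the form $\sum_{i,j}\theta_i\alpha_{i,j}\overline{\theta_j}$ is Kähler. Since $(1,1)$-forms commute, $\det(M)=\sum_{\sigma\in S_k}\mathrm{sgn}(\sigma)\alpha_{1,\sigma(1)}\wedge\dots\wedge\alpha_{k,\sigma(k)}\in V^{k,k}$ is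 well defined. Fix a Kähler form $\omega$ and define $\star:V^{n,n}\to\mathbb{C}$ by $\eta=\star(\eta)\,\omega^n/n!$. For $\Omega\in V^{k,k}$ and $p+q=n-k$: $\Omega$ satisfies HLT for $(p,q)$ (is a Lefschetz form for $(p,q)$) if $\alpha\mapsto\alpha\wedge\Omega$ is an isomorphism $V^{p,q}\to V^{n-q,n-p}$; define $Q(\alpha,\beta)=(\sqrt{-1})^{p-q}(-1)^{\frac{(p+q)(p+q-1)}{2}}\star(\alpha\wedge\overline{\beta}\wedge\Omega)$ on $V^{p,q}$ and $P^{p,q}=\{\alpha\in V^{p,q}:\alpha\wedge\Omega\wedge\omega=0\}$; $\Omega$ satisfies HRR for $(p,q)$ if $Q$ is positive definite on $P^{p,q}$; $\Omega$ satisfies LD for $(p,q)$ if $V^{p,q}=(\omega\wedge V^{p-1,q-1})\oplus P^{p,q}$ and this decomposition is orthogonal with respect to $Q$. *)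

(* Defs.v *)
(* Complex numbers: C := R[i] with R the Stdlib reals
   (a realType, hence rcfType), so C is the genuine field of complex numbers. *)
From mathcomp Require Import all_boot all_order all_algebra.
From mathcomp Require Import Rstruct complex.
Set Implicit Arguments. Unset Strict Implicit. Unset Printing Implicit Defensive.
Import Order.TTheory GRing.Theory Num.Theory.
Local Open Scope ring_scope.

Definition C : numClosedFieldType := (Rdefinitions.R)[i].

(* Constant coefficient forms on C^n (the full exterior algebra of V (+) Vbar).
   A form f is sum_{(I,J)} f (I,J) dz_I /\ dzbar_J, where dz_I is the wedge of
   the dz_i, i in I, in increasing order, and likewise dzbar_J. *)
Definition cform (n : nat) := {ffun {set 'I_n} * {set 'I_n} -> C}.

(* f is in V^{p,q} *)
Definition is_pq (n p q : nat) (f : cform n) : Prop :=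
  forall a : {set 'I_n} * {set 'I_n}, f a != 0 -> #|a.1| = p /\ #|a.2| = q.

(* number of inversions between two index sets *)
Definition ninv n (A B : {set 'I_n}) : nat :=
  #|[set x : 'I_n * 'I_n | (x.1 \in A) && (x.2 \in B) && (x.2 < x.1)%N]|.

(* sign of  (dz_I dzbar_J) /\ (dz_K dzbar_L) = sgn * dz_{I u K} dzbar_{J u L} *)
Definition wsign n (a b : {set 'I_n} * {set 'I_n}) : C :=
  (-1) ^+ (ninv a.1 b.1 + ninv a.2 b.2 + #|a.2| * #|b.1|).

Definition wedge n (f g : cform n) : cform n :=
  [ffun x : {set 'I_n} * {set 'I_n} => \sum_(a : {set 'I_n} * {set 'I_n}) \sum_(b : {set 'I_n} * {set 'I_n})
     if [&& a.1 :&: b.1 == set0, a.2 :&: b.2 == set0 & x == (a.1 :|: b.1, a.2 :|: b.2)]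
     then wsign a b * f a * g b else 0].

(* complex conjugation of forms: conj (c dz_I dzbar_J) = cbar dzbar_I dz_J
   = (-1)^{|I||J|} cbar dz_J dzbar_I *)
Definition fconj n (f : cform n) : cform n :=
  [ffun x : {set 'I_n} * {set 'I_n} => (-1) ^+ (#|x.1| * #|x.2|) * (f (x.2, x.1))^*].

(* the unit 1 and the one-forms dz_k *)
Definition fone n : cform n := [ffun x : {set 'I_n} * {set 'I_n} => if x == (set0, set0) then 1 else 0].
Definition dz n (k : 'I_n) : cform n := [ffun x : {set 'I_n} * {set 'I_n} => if x == ([set k], set0) then 1 else 0].

Definition fpow n (w : cform n) (m : nat) : cform n := iter m (wedge w) (fone n).

(* Kahler: omega = sum_l (sqrt(-1)/2) dw_l /\ dwbar_l for complex linear
   coordinates w = A z (A invertible). *)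
Definition is_kahler n (w : cform n) : Prop :=
  exists A : 'M[C]_n, A \in unitmx /\
    w = \sum_(l < n) ('i / 2%:R) *:
          wedge (\sum_(k < n) A l k *: dz k) (fconj (\sum_(k < n) A l k *: dz k)).

(* Griffiths positive Hermitian 2x2 matrix of (1,1)-forms *)
Definition is_hermitian2 n (M : 'I_2 -> 'I_2 -> cform n) : Prop :=
  (forall i j, is_pq 1 1 (M i j)) /\ (forall i j, M i j = fconj (M j i)).

Definition griffiths_pos2 n (M : 'I_2 -> 'I_2 -> cform n) : Prop :=
  is_hermitian2 M /\
  forall theta : 'I_2 -> C, (exists i, theta i != 0) ->
    is_kahler (\sum_(i < 2) \sum_(j < 2) (theta i * (theta j)^*) *: M i j).

Definition det2 n (M : 'I_2 -> 'I_2 -> cform n) : cform n :=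
  wedge (M 0 0) (M 1 1) - wedge (M 0 1) (M 1 0).

(* star : V^{n,n} -> C, eta = star eta * omega^n / n!  (V^{n,n} is spanned by
   the basis element indexed by (setT, setT)). *)
Definition fstar n (w eta : cform n) : C :=
  eta (setT, setT) / ((fpow w n) (setT, setT) / (n`!)%:R).

Definition HLT n (w Om : cform n) (p q : nat) : Prop :=
  (forall a b, is_pq p q a -> is_pq p q b -> wedge a Om = wedge b Om -> a = b) /\
  (forall c, is_pq (n - q) (n - p) c -> exists a, is_pq p q a /\ wedge a Om = c).

Definition Qform n (w Om : cform n) (p q : nat) (a b : cform n) : C :=
  'i ^ (p%:Z - q%:Z) * (-1) ^+ ((p + q) * (p + q).-1)./2 *
  fstar w (wedge (wedge a (fconj b)) Om).

Definition primitive n (w Om : cform n) (p q : nat) (a : cform n) : Prop :=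
  is_pq p q a /\ wedge (wedge a Om) w = 0.

Definition HRR n (w Om : cform n) (p q : nat) : Prop :=
  forall a, primitive w Om p q a -> a != 0 -> 0 < Qform w Om p q a a.

(* omega /\ V^{p-1,q-1}, with V^{p-1,q-1} = 0 when p = 0 or q = 0 *)
Definition Lpart n (w : cform n) (p q : nat) (a : cform n) : Prop :=
  a = 0 \/ ((0 < p)%N /\ (0 < q)%N /\ exists g, is_pq p.-1 q.-1 g /\ a = wedge w g).

Definition LD n (w Om : cform n) (p q : nat) : Prop :=
  (forall a, is_pq p q a ->
     exists b c, Lpart w p q b /\ primitive w Om p q c /\ a = b + c) /\
  (forall a, Lpart w p q a -> primitive w Om p q a -> a = 0) /\
  (forall b c, Lpart w p q b -> primitive w Om p q c ->
     Qform w Om p q b c = 0 /\ Qform w Om p q c b = 0).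

(* Main.v *)
(* With the forms [alpha_ij] written as coefficient matrices, the value of
   [det M] on a pair of vectors x, y is a difference of mixed discriminants of
   sesquilinear forms, unchanged when y is replaced by y + t x.  Choosing t so
   that x and y are orthogonal for [alpha_11], it equals
     p d' + p' d - 2 Re (b conj b') + |c|^2 + |c'|^2
   with p, d, b and p', d', b' the values of [alpha_11], [alpha_22], [alpha_12]
   at (x, x) and at (y, y), and c, c' those of [alpha_12] at (x, y) and (y, x);
   here Griffiths positivity at x and at y gives |b|^2 < p d and
   |b'|^2 < p' d', so it is positive.  For n = 2 this is the whole claim.
   For n = 3, restricting [det M] to the plane orthogonal to u (Cauchy-Binet)
   shows that the Hermitian matrix of [det M] in complementary coordinates is
   positive definite; this gives HRR, hence HLT.  For these bidegrees every
   form is primitive and there is nothing divisible by omega, so LD is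
   immediate. *)
Require Import Defs.
From mathcomp Require Import all_boot all_order all_algebra.
From mathcomp Require Import Rstruct complex.
From mathcomp Require Import ring.
Set Implicit Arguments. Unset Strict Implicit. Unset Printing Implicit Defensive.
Import Order.TTheory GRing.Theory Num.Theory.
Local Open Scope ring_scope.

(** * Sesquilinear forms, mixed discriminants and Griffiths positivity for coefficient matrices *)

Section Sesquilinear.
Variables (K : numClosedFieldType) (n : nat).
Implicit Types (A B : 'M[K]_n) (x y : 'I_n -> K).

Definition sesq A x y : K := \sum_k \sum_l x k * A k l * (y l)^*.

Lemma sesqDr A x y z t :
  sesq A z (fun k => y k + t * x k) = sesq A z y + t^* * sesq A z x.
Proof.
rewrite /sesq mulr_sumr -big_split; apply: eq_bigr => k _ /=.
rewrite mulr_sumr -big_split; apply: eq_bigr => l _ /=.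
by rewrite rmorphD rmorphM /=; ring.
Qed.

Lemma sesqDl A x y z t :
  sesq A (fun k => y k + t * x k) z = sesq A y z + t * sesq A x z.
Proof.
rewrite /sesq mulr_sumr -big_split; apply: eq_bigr => k _ /=.
rewrite mulr_sumr -big_split; apply: eq_bigr => l _ /=; ring.
Qed.

Lemma sesq_scale c A x y : sesq (c *: A) x y = c * sesq A x y.
Proof.
rewrite /sesq mulr_sumr; apply: eq_bigr => k _; rewrite mulr_sumr; apply: eq_bigr => l _.
by rewrite mxE; ring.
Qed.

Lemma sesq_conj A B x y : (forall k l, A k l = (B l k)^*) -> sesq A x y = (sesq B y x)^*.
Proof.
move=> AB; rewrite /sesq rmorph_sum exchange_big; apply: eq_bigr => l _ /=.
rewrite rmorph_sum; apply: eq_bigr => k _ /=.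
by rewrite !rmorphM /= conjCK AB; ring.
Qed.

(** Polarisation of the Gram determinant of a sesquilinear form on the pair [x], [y]; for [A = B] it
    is twice that determinant. *)
Definition mixdisc A B x y : K :=
  sesq A x x * sesq B y y + sesq A y y * sesq B x x
  - sesq A x y * sesq B y x - sesq A y x * sesq B x y.

(** The shear acts on both Gram matrices by a row operation and the conjugate column operation, each
    of determinant one, so the polarised determinant does not change. *)
Lemma mixdisc_shear A B x y t : mixdisc A B x (fun k => y k + t * x k) = mixdisc A B x y.
Proof.
set z := fun k => _; have Dl D w : sesq D z w = sesq D y w + t * sesq D x w by apply: sesqDl.
have Dr D w : sesq D w z = sesq D w y + t^* * sesq D w x by apply: sesqDr.
by rewrite /mixdisc !Dl !Dr; ring.
Qed.

(** Positivity is asked only on decomposable tensors of [th] with [x]; on all tensors it would be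
    Nakano positivity. *)
Definition griffiths (N : 'I_2 -> 'I_2 -> 'M[K]_n) : Prop :=
  (forall i j k l, N i j k l = (N j i l k)^*) /\
  forall (th : 'I_2 -> K) x, (exists i, th i != 0) -> (exists k, x k != 0) ->
    0 < sesq (\sum_i \sum_j (th i * (th j)^*) *: N i j) x x.

Lemma sesq_sum2 (N : 'I_2 -> 'I_2 -> 'M[K]_n) (th : 'I_2 -> K) x :
  sesq (\sum_i \sum_j (th i * (th j)^*) *: N i j) x x =
  th 0 * (th 0)^* * sesq (N 0 0) x x + th 0 * (th 1)^* * sesq (N 0 1) x x
  + th 1 * (th 0)^* * sesq (N 1 0) x x + th 1 * (th 1)^* * sesq (N 1 1) x x.
Proof.
rewrite /sesq !mulr_sumr -!big_split; apply: eq_bigr => k _ /=.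
rewrite !mulr_sumr -!big_split; apply: eq_bigr => l _ /=.
rewrite !big_ord_recl !big_ord0 !mxE.
rewrite (_ : ord0 = 0 :> 'I_1) // (_ : lift ord0 ord0 = 1); last exact/val_inj.
rewrite (_ : ord0 = 0) //; ring.
Qed.

Lemma griffiths_diag (N : 'I_2 -> 'I_2 -> 'M[K]_n) x : griffiths N -> (exists k, x k != 0) ->
  [/\ 0 < sesq (N 0 0) x x, 0 < sesq (N 1 1) x x &
      `|sesq (N 0 1) x x| ^+ 2 < sesq (N 0 0) x x * sesq (N 1 1) x x].
Proof.
move=> [herm pos] x0.
have h00 : 0 < sesq (N 0 0) x x.
  have := pos (fun i => (i == 0)%:R) x _ x0.
  rewrite sesq_sum2 /= !rmorph_nat !(mul0r, mulr0, mul1r, addr0) => -> //.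
  by exists 0; rewrite oner_eq0.
have h11 : 0 < sesq (N 1 1) x x.
  have := pos (fun i => (i == 1)%:R) x _ x0.
  rewrite sesq_sum2 /= !rmorph_nat !(mul0r, mulr0, mul1r, add0r) => -> //.
  by exists 1; rewrite oner_eq0.
split=> //; set p := sesq (N 0 0) x x in h00 *; set d := sesq (N 1 1) x x in h11 *.
set b := sesq (N 0 1) x x.
have hb : sesq (N 1 0) x x = b^* by apply: sesq_conj => k l; apply: herm.
have := pos (fun i => if i == 0 then d else - b) x _ x0.
rewrite sesq_sum2 /= -/p -/d -/b hb rmorphN (CrealP (gtr0_real h11)) => H.
rewrite -subr_gt0 -(pmulr_rgt0 _ h11) normCK.
rewrite (_ : d * _ = d * d * p + d * - b^* * b + - b * d * b^* + - b * - b^* * d); last by ring.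
by apply: H; exists 0; rewrite gt_eqF.
Qed.

(* Shearing [y] along [x] makes [x], [y] orthogonal for [N 0 0]; the only
   negative term left is then the one bounded by Griffiths positivity at
   [x] and at [y], through Cauchy-Schwarz and AM-GM. *)
Lemma griffiths_mixdisc (N : 'I_2 -> 'I_2 -> 'M[K]_n) x y :
  griffiths N -> (exists k, x k != 0) ->
  (forall t, exists k, y k + t * x k != 0) ->
  0 < mixdisc (N 0 0) (N 1 1) x y - mixdisc (N 0 1) (N 1 0) x y.
Proof.
move=> gN x0 y0; have [herm _] := gN.
have [p0 d0 b0] := griffiths_diag gN x0.
pose t := - (sesq (N 0 0) y x / sesq (N 0 0) x x).
rewrite -!(mixdisc_shear _ _ x y t).
set z := fun k => y k + t * x k.
have [p1 d1 b1] := griffiths_diag gN (y0 t : exists k, z k != 0).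
have zx : sesq (N 0 0) z x = 0.
  by rewrite sesqDl /t mulNr divfK ?subrr // gt_eqF.
have xz : sesq (N 0 0) x z = 0.
  by rewrite (sesq_conj _ _ (herm 0 0)) zx conjC0.
rewrite /mixdisc zx xz !(sesq_conj _ _ (herm 1 0)) !mul0r !subr0.
move: b0 b1; set p := sesq (N 0 0) x x in p0 *; set d := sesq (N 1 1) x x in d0 *.
set p' := sesq (N 0 0) z z in p1 *; set d' := sesq (N 1 1) z z in d1 *.
set b := sesq (N 0 1) x x; set b' := sesq (N 0 1) z z.
set c := sesq (N 0 1) x z; set c' := sesq (N 0 1) z x => b0 b1.
rewrite !opprD !opprK -!normCK.
suff H : b * b'^* + b' * b^* < p * d' + p' * d.
  rewrite [ltRHS](_ : _ = (p * d' + p' * d - (b * b'^* + b' * b^*)) + (`|c| ^+ 2 + `|c'| ^+ 2)); last by ring.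
  by apply: ltr_wpDr; rewrite ?subr_gt0 ?addr_ge0 ?exprn_ge0.
have le1 : b * b'^* + b' * b^* <= `|b| * `|b'| *+ 2.
  have r : b * b'^* + b' * b^* \is Num.real.
    by apply/CrealP; rewrite rmorphD !rmorphM /= !conjCK; ring.
  apply: le_trans (real_ler_norm r) _; apply: le_trans (ler_normD _ _) _.
  by rewrite !normrM !norm_conjC [`|b'| * _]mulrC mulr2n.
apply: le_lt_trans le1 _.
have pd : 0 < p * d' + p' * d by rewrite addr_gt0 ?mulr_gt0.
rewrite -(ltr_pXn2r (n := 2)) ?nnegrE ?mulrn_wge0 ?mulr_ge0 ?(ltW pd) //.
apply: lt_le_trans (_ : (p * d) * (p' * d') *+ 4 <= _).
  rewrite (_ : (_ *+ 2) ^+ 2 = `|b| ^+ 2 * `|b'| ^+ 2 *+ 4); last by ring.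
  by rewrite ltr_pMn2r // ltr_pM ?exprn_ge0.
rewrite -subr_ge0 (_ : _ - _ = (p * d' - p' * d) ^+ 2); last by ring.
by rewrite real_exprn_even_ge0 // rpredB // rpredM // gtr0_real.
Qed.

End Sesquilinear.

(** * Wedge products and their signs in coordinates *)

Section Forms.
Variable n : nat.
Implicit Types (f g : cform n) (x : {set 'I_n} * {set 'I_n}).

Lemma is_pq_eq0 p q f x : is_pq p q f -> (#|x.1|, #|x.2|) != (p, q) -> f x = 0.
Proof. by move=> fpq; apply: contraNeq => /fpq [-> ->]. Qed.

Lemma wedgeE f g x : wedge f g x =
  \sum_(A : {set 'I_n}) \sum_(B : {set 'I_n}) if (A \subset x.1) && (B \subset x.2) then
    wsign (A, B) (x.1 :\: A, x.2 :\: B) * f (A, B) * g (x.1 :\: A, x.2 :\: B) else 0.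
Proof.
rewrite ffunE [RHS]pair_bigA; apply: eq_bigr => a _; rewrite -big_mkcond /=.
have compl (I A B : {set 'I_n}) : A \subset I ->
    (A :&: B == set0) && (I == A :|: B) = (B == I :\: A).
  move=> AI; apply/andP/eqP => [[/eqP AB /eqP ->]|->].
    by rewrite setDUl setDv set0U; apply/esym/setDidPl; rewrite disjoint_sym -setI_eq0 AB.
  split; apply/eqP/setP => y; rewrite !inE; first by case: (y \in A).
  by have /implyP := subsetP AI y; case: (y \in A) (y \in I) => [] [].
case: ifP => [/andP[s1 s2]|sub].
  rewrite (big_pred1 (x.1 :\: a.1, x.2 :\: a.2)) => [|b].
    by case: a {s1 s2}.
  case: x s1 s2 b => I J /= s1 s2 [b1 b2] /=; rewrite !xpair_eqE.
  by rewrite -(compl I) // -(compl J) // andbACA -andbA.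
rewrite big1 // => b /and3P[_ _ /eqP xE].
by rewrite xE /= !subsetUl in sub.
Qed.

Lemma wedge_pq p q p' q' f g :
  is_pq p q f -> is_pq p' q' g -> is_pq (p + p') (q + q') (wedge f g).
Proof.
move=> fpq gpq x fx; suff: (#|x.1|, #|x.2|) == (p + p', q + q')%N by case/eqP => -> ->.
apply: contraNT fx => npq; rewrite ffunE big1 // => a _.
rewrite big1 // => b _; case: ifP => // /and3P[/eqP d1 /eqP d2 /eqP xE].
have [->|fa] := eqVneq (f a) 0; first by rewrite mulr0 mul0r.
have [->|gb] := eqVneq (g b) 0; first by rewrite mulr0.
case/eqP: npq; have [<- <-] := fpq _ fa; have [<- <-] := gpq _ gb.
by rewrite xE /= !cardsU d1 d2 !cards0 !subn0.
Qed.

Lemma sum_set1 (F : {set 'I_n} -> C) :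
  (forall A : {set 'I_n}, #|A| != 1%N -> F A = 0) -> \sum_A F A = \sum_k F [set k].
Proof.
move=> F0; rewrite (bigID (mem [set [set k] | k in 'I_n])) /= [X in _ + X]big1 ?addr0.
  by rewrite big_imset //= => i j _ _; apply: set1_inj.
move=> A /imsetP nA; apply: F0; apply/cards1P => -[k kA]; apply: nA; by exists k.
Qed.

Lemma sum_set0 (F : {set 'I_n} -> C) :
  (forall A : {set 'I_n}, #|A| != 0%N -> F A = 0) -> \sum_A F A = F set0.
Proof.
move=> F0; rewrite (bigD1 set0) //= big1 ?addr0 // => A; rewrite -cards_eq0; exact: F0.
Qed.

Lemma ninv0l (B : {set 'I_n}) : ninv set0 B = 0%N.
Proof. by apply/eqP; rewrite cards_eq0; apply/eqP/setP => a; rewrite !inE. Qed.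

Lemma ninv0r (B : {set 'I_n}) : ninv B set0 = 0%N.
Proof. by apply/eqP; rewrite cards_eq0; apply/eqP/setP => a; rewrite !inE andbF. Qed.

Lemma ninv1l (k : 'I_n) (B : {set 'I_n}) : ninv [set k] B = #|[set y in B | (y < k)%N]|.
Proof.
rewrite /ninv -[RHS](card_imset _ (_ : injective (pair k))); last by move=> i j [].
apply: eq_card => -[i j]; rewrite !inE /=; apply/idP/imsetP.
  by case/andP=> /andP[/eqP -> jB] jk; exists j; rewrite // inE jB.
by case=> y; rewrite inE => /andP[yB yk] [-> ->]; rewrite eqxx yB.
Qed.

(** Source of the cofactor signs [(-1) ^+ k]: moving dz_k into place among the other indices passes
    exactly the indices below [k]. *)
Lemma ninv1C (k : 'I_n) : ninv [set k] [set~ k] = k.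
Proof.
have inj : injective (widen_ord (ltnW (ltn_ord k))).
  by move=> i j /(congr1 val) /= /val_inj.
rewrite ninv1l -[RHS](card_ord k) -[RHS](card_imset _ inj).
apply: eq_card => y; rewrite !inE; apply/idP/imsetP.
  by case/andP=> _ yk; exists (Ordinal yk) => //; apply/val_inj.
by case=> z _ ->; rewrite -val_eqE /= ltn_ord andbT ltn_eqF.
Qed.

Lemma ninv11 (k l : 'I_n) : ninv [set k] [set l] = (l < k)%N.
Proof.
rewrite ninv1l; case: ltnP => lk.
  rewrite (_ : [set y in _ | _] = [set l]) ?cards1 //; apply/setP=> y.
  by rewrite !inE; case: eqP => // ->.
apply/eqP; rewrite cards_eq0; apply/eqP/setP=> y; rewrite !inE.
by case: eqP => // ->; rewrite ltnNge lk.
Qed.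

Lemma wedge11 f g x : is_pq 1 1 f -> wedge f g x =
  \sum_(k in x.1) \sum_(l in x.2)
    wsign ([set k], [set l]) (x.1 :\ k, x.2 :\ l) * f ([set k], [set l]) * g (x.1 :\ k, x.2 :\ l).
Proof.
move=> f11; rewrite wedgeE.
rewrite sum_set1 => [|A A1]; last first.
  by rewrite big1 // => B _; rewrite (is_pq_eq0 f11) ?xpair_eqE ?negb_and ?A1 // mulr0 mul0r if_same.
rewrite [RHS]big_mkcond; apply: eq_bigr => k _; rewrite sub1set.
rewrite sum_set1 => [|A A1]; last first.
  by rewrite (is_pq_eq0 f11) ?xpair_eqE ?negb_and ?A1 ?orbT // mulr0 mul0r if_same.
case: ifP => _; last by rewrite big1.
by rewrite [RHS]big_mkcond; apply: eq_bigr => l _; rewrite sub1set.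
Qed.

Lemma wedge10 f g x : is_pq 1 0 f -> wedge f g x =
  \sum_(k in x.1)
    wsign ([set k], set0) (x.1 :\ k, x.2) * f ([set k], set0) * g (x.1 :\ k, x.2).
Proof.
move=> f11; rewrite wedgeE.
rewrite sum_set1 => [|A A1]; last first.
  by rewrite big1 // => B _; rewrite (is_pq_eq0 f11) ?xpair_eqE ?negb_and ?A1 // mulr0 mul0r if_same.
rewrite [RHS]big_mkcond; apply: eq_bigr => k _; rewrite sub1set.
rewrite sum_set0 => [|A A1]; last first.
  by rewrite (is_pq_eq0 f11) ?xpair_eqE ?negb_and ?A1 ?orbT // mulr0 mul0r if_same.
by rewrite sub0set andbT setD0.
Qed.

Lemma wedge01 f g x : is_pq 0 1 f -> wedge f g x =
  \sum_(l in x.2)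
    wsign (set0, [set l]) (x.1, x.2 :\ l) * f (set0, [set l]) * g (x.1, x.2 :\ l).
Proof.
move=> f11; rewrite wedgeE.
rewrite sum_set0 => [|A A1]; last first.
  by rewrite big1 // => B _; rewrite (is_pq_eq0 f11) ?xpair_eqE ?negb_and ?A1 // mulr0 mul0r if_same.
rewrite sum_set1 => [|A A1]; last first.
  by rewrite (is_pq_eq0 f11) ?xpair_eqE ?negb_and ?A1 ?orbT // mulr0 mul0r if_same.
rewrite [RHS]big_mkcond; apply: eq_bigr => k _; rewrite sub1set.
by rewrite sub0set setD0.
Qed.

Lemma wedge00 f g x : is_pq 0 0 f -> wedge f g x = f (set0, set0) * g x.
Proof.
move=> f11; rewrite wedgeE.
rewrite sum_set0 => [|A A1]; last first.
  by rewrite big1 // => B _; rewrite (is_pq_eq0 f11) ?xpair_eqE ?negb_and ?A1 // mulr0 mul0r if_same.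
rewrite sum_set0 => [|A A1]; last first.
  by rewrite (is_pq_eq0 f11) ?xpair_eqE ?negb_and ?A1 ?orbT // mulr0 mul0r if_same.
by rewrite !sub0set !setD0 /wsign /= !ninv0l cards0 mul0n mul1r; case: x.
Qed.

Lemma wedge1r f : wedge f (fone n) = f.
Proof.
apply/ffunP => x; rewrite wedgeE pair_bigA (bigD1 x) ?subxx //= big1 => [|a ax];
  last case: ifP => // /andP[s1 s2].
  by rewrite !setDv ffunE eqxx /wsign /= !ninv0r cards0 muln0 mul1r mulr1 addr0; case: x.
rewrite ffunE xpair_eqE !setD_eq0; case: ifP => [/andP[s3 s4]|_]; last by rewrite mulr0.
case/eqP: ax; case: a x s1 s2 s3 s4 => a b [c d] /= s1 s2 s3 s4.
by congr pair; apply/eqP; rewrite eqEsubset ?s1 ?s2 ?s3 ?s4.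
Qed.

End Forms.

(** * Mixed minors of order two *)

Section Minors.
Variables (K : numClosedFieldType) (n : nat).
Implicit Types (A B : 'M[K]_n) (x y : 'I_n -> K).

(** Polarised minor on rows [i], [j] and columns [k], [l]; when the columns are again [i], [j] it is
    [mixdisc] at two basis vectors. *)
Definition minor2 A B i j k l : K :=
  A i k * B j l + A j l * B i k - A i l * B j k - A j k * B i l.

Lemma minor20 i j k l : minor2 0 0 i j k l = 0.
Proof. by rewrite /minor2 !mxE; ring. Qed.

Lemma sesqZ A x c : sesq A (fun k => c * x k) (fun k => c * x k) = `|c| ^+ 2 * sesq A x x.
Proof.
rewrite /sesq mulr_sumr; apply: eq_bigr => k _; rewrite mulr_sumr; apply: eq_bigr => l _.
by rewrite rmorphM /= normCK; ring.
Qed.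

Definition basis_vec (i : 'I_n) : 'I_n -> K := fun k => (k == i)%:R.

Lemma sesq_basis A i j : sesq A (basis_vec i) (basis_vec j) = A i j.
Proof.
rewrite /sesq (bigD1 i) //= [X in _ + X]big1 ?addr0 => [|k /negPf ki]; last first.
  by rewrite big1 // => l _; rewrite /basis_vec ki !mul0r.
rewrite (bigD1 j) //= [X in _ + X]big1 ?addr0 => [|l /negPf lj]; last first.
  by rewrite /basis_vec lj conjC0 mulr0.
by rewrite /basis_vec !eqxx conjC1 mul1r mulr1.
Qed.

Lemma griffiths_minor2 (N : 'I_2 -> 'I_2 -> 'M[K]_n) i j : griffiths N -> i != j ->
  0 < minor2 (N 0 0) (N 1 1) i j i j - minor2 (N 0 1) (N 1 0) i j i j.
Proof.
move=> gN ij; have := griffiths_mixdisc (x := basis_vec i) (y := basis_vec j) gN.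
rewrite /mixdisc !sesq_basis; apply.
  by exists i; rewrite /basis_vec eqxx oner_eq0.
by move=> t; exists j; rewrite /basis_vec eqxx [j == i]eq_sym (negPf ij) mulr0 addr0 oner_eq0.
Qed.

Lemma sesqB A B x y : sesq (A - B) x y = sesq A x y - sesq B x y.
Proof.
rewrite /sesq -sumrB; apply: eq_bigr => k _; rewrite -sumrB; apply: eq_bigr => l _.
by rewrite !mxE; ring.
Qed.

Lemma eq_sesq A x y : x =1 y -> sesq A x x = sesq A y y.
Proof. by move=> xy; apply: eq_bigr => k _; apply: eq_bigr => l _; rewrite !xy. Qed.

End Minors.

(** * Dimension three: mixed cofactors and cross products *)

Section Dim3.
Variable (K : numClosedFieldType).
Implicit Types (A B : 'M[K]_3) (x y : 'I_3 -> K).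

(** Polarised cofactor matrix: [cofmx2 A A] is twice the cofactor matrix of [A]. The lifts of [ord0]
    and [ord_max] at [k] are the two indices other than [k], in increasing order. *)
Definition cofmx2 A B : 'M[K]_3 := \matrix_(k < 3, l < 3) ((-1) ^+ (k + l) *
  minor2 A B (lift k ord0) (lift k ord_max) (lift l ord0) (lift l ord_max)).

Definition cross x y (k : 'I_3) : K := (-1) ^+ k *
  (x (lift k ord0) * y (lift k ord_max) - x (lift k ord_max) * y (lift k ord0)).

Lemma lift3E : let o0 := 0 : 'I_3 in let o1 := 1 : 'I_3 in let o2 := 2%:R : 'I_3 in
  ((ord0 = o0) * (lift ord0 ord0 = o1) * (lift ord0 (lift ord0 ord0) = o2) *
  ((lift o0 ord0 = o1) * (lift o0 ord_max = o2) * (lift o1 ord0 = o0) *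
   (lift o1 ord_max = o2) * (lift o2 ord0 = o0) * (lift o2 ord_max = o1)))%type.
Proof. by do !split; apply/val_inj. Qed.

Lemma sum3 (F : 'I_3 -> K) : \sum_k F k = F 0 + F 1 + F 2%:R.
Proof. by rewrite !big_ord_recl big_ord0 !lift3E addr0 addrA. Qed.

(* Cauchy-Binet *)
Lemma mixdisc_cross A B x y :
  mixdisc A B x y = sesq (cofmx2 A B) (cross x y) (cross x y).
Proof.
rewrite /mixdisc /sesq !sum3 !mxE /cross /minor2 !lift3E /=.
rewrite (_ : (1 %% 3 + 1 %% 3) %% 3 = 2)%N // (_ : 1 %% 3 = 1)%N //.
rewrite !(rmorphM, rmorphB, rmorphXn, rmorphN, rmorph1) /=; ring.
Qed.

Lemma I3P (k : 'I_3) : [\/ k = 0, k = 1 | k = 2%:R].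
Proof.
by case: k => -[|[|[|]]] // ?; [constructor 1|constructor 2|constructor 3]; apply/val_inj.
Qed.

(** Two independent vectors annihilated by [u] under the bilinear pairing have a cross product
    proportional to [u]. The condition over all [t] says that [y] is not a multiple of [x]. *)
Lemma cross_onto (u : 'I_3 -> K) : (exists k, u k != 0) ->
  exists c x y, [/\ c != 0, exists k, x k != 0, forall t, exists k, y k + t * x k != 0 &
    cross x y =1 (fun k => c * u k)].
Proof.
pose v a b c : 'I_3 -> K := fun k => [:: a; b; c]`_k.
suff wit c x y i j : c != 0 -> x i != 0 -> x j = 0 -> y j != 0 ->
    cross x y 0 = c * u 0 -> cross x y 1 = c * u 1 -> cross x y 2%:R = c * u 2%:R ->
    exists c x y, [/\ c != 0, exists k, x k != 0, forall t, exists k, y k + t * x k != 0 &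
    cross x y =1 (fun k => c * u k)].
  (* For a nonzero coordinate [u k], the two vectors solve the equation of the plane with one free
     coordinate set to zero each; the scale [c] is then [u k] itself. Since [x] vanishes at [j] and
     [y] does not, [y + t x] is nonzero at [j]. *)
  case=> k uk; have [kE|kE|kE] := I3P k; rewrite kE in uk.
  - apply: (wit _ (v (- u 1) (u 0) 0) (v (- u 2%:R) 0 (u 0)) 1 2%:R uk) => //;
    rewrite /cross !lift3E /v /=; ring.
  - apply: (wit _ (v (- u 1) (u 0) 0) (v 0 (- u 2%:R) (u 1)) 0 2%:R uk) => //; rewrite /v /= ?oppr_eq0 //;
    rewrite /cross !lift3E /v /=; ring.
  - apply: (wit _ (v (- u 2%:R) 0 (u 0)) (v 0 (- u 2%:R) (u 1)) 0 1 uk) => //; rewrite /v /= ?oppr_eq0 //;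
    rewrite /cross !lift3E /v /=; ring.
move=> c0 xi xj yj e0 e1 e2; exists c, x, y; split=> //; first by exists i.
  by move=> t; exists j; rewrite xj mulr0 addr0.
by move=> k; have [->|->|->] := I3P k.
Qed.

(** Writing [u] as a cross product up to [c] turns the value into a difference of mixed
    discriminants, already positive; the scaling only costs the positive factor [|c| ^+ 2]. *)
Lemma griffiths_cofmx2 (N : 'I_2 -> 'I_2 -> 'M[K]_3) u : griffiths N -> (exists k, u k != 0) ->
  0 < sesq (cofmx2 (N 0 0) (N 1 1) - cofmx2 (N 0 1) (N 1 0)) u u.
Proof.
move=> gN /cross_onto[c [x [y [c0 x0 y0 xy]]]].
have := griffiths_mixdisc gN x0 y0; rewrite !mixdisc_cross !(eq_sesq _ xy) !sesqZ -mulrBr sesqB.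
by rewrite pmulr_rgt0 // exprn_gt0 ?normr_gt0.
Qed.

End Dim3.

(** * From (1,1)-forms to Hermitian coefficient matrices *)

Section Coefficients.
Variable n : nat.
Implicit Types (f g w : cform n).

Lemma is_pq_sum (I : Type) (r : seq I) (F : I -> cform n) p q :
  (forall i, is_pq p q (F i)) -> is_pq p q (\sum_(i <- r) F i).
Proof.
move=> Fpq x; rewrite sum_ffunE => nz.
suff: (#|x.1|, #|x.2|) == (p, q) by case/eqP => -> ->.
apply: contraNT nz => npq; rewrite big1 // => i _.
exact: is_pq_eq0 (Fpq i) npq.
Qed.

Lemma is_pqZ c f p q : is_pq p q f -> is_pq p q (c *: f).
Proof. by move=> fpq x; rewrite ffunE mulf_eq0 negb_or => /andP[_ /fpq]. Qed.

Lemma fconj_pq p q f : is_pq p q f -> is_pq q p (fconj f).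
Proof.
move=> fpq x; rewrite ffunE mulf_eq0 negb_or conjC_eq0 => /andP[_ /fpq].
by case.
Qed.

Lemma fconj10 f (k : 'I_n) : fconj f ([set k], set0) = (f (set0, [set k]))^*.
Proof. by rewrite ffunE /= cards0 muln0 mul1r. Qed.

Lemma fconj01 f (k : 'I_n) : fconj f (set0, [set k]) = (f ([set k], set0))^*.
Proof. by rewrite ffunE /= cards0 mul1r. Qed.

Lemma fconj11 f (k l : 'I_n) : fconj f ([set k], [set l]) = - (f ([set l], [set k]))^*.
Proof. by rewrite ffunE /= !cards1 mulN1r. Qed.

Lemma wedge10_1 f g (k l : 'I_n) : is_pq 1 0 f ->
  wedge f g ([set k], [set l]) = f ([set k], set0) * g (set0, [set l]).
Proof.
move=> fpq; rewrite wedge10 //= big_set1 setDv.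
by rewrite /wsign /= ninv0r ninv0l cards0 mul1r.
Qed.

Lemma wedge01_1 f g (k l : 'I_n) : is_pq 0 1 f ->
  wedge f g ([set k], [set l]) = - (f (set0, [set l]) * g ([set k], set0)).
Proof.
move=> fpq; rewrite wedge01 //= big_set1 setDv.
by rewrite /wsign /= ninv0r ninv0l !cards1 mulN1r mulNr.
Qed.

Lemma dz_pq (k : 'I_n) : is_pq 1 0 (dz k).
Proof.
by move=> x; rewrite ffunE; case: (x =P _) => [-> _|_]; rewrite ?eqxx //= cards1 cards0.
Qed.

Lemma dz_sumE (a : 'I_n -> C) l : (\sum_k a k *: dz k) ([set l], set0) = a l.
Proof.
rewrite sum_ffunE (bigD1 l) //= big1 ?addr0 => [|k kl].
  by rewrite !ffunE eqxx [_ *: _]mulr1.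
rewrite !ffunE xpair_eqE eqxx andbT (inj_eq set1_inj) eq_sym (negPf kl).
exact: mulr0.
Qed.

Lemma kahler_coef w : is_kahler w -> is_pq 1 1 w /\
  exists2 A : 'M[C]_n, A \in unitmx & forall k l,
    w ([set k], [set l]) = 'i / 2%:R * \sum_m A m k * (A m l)^*.
Proof.
case=> A [uA ->].
have pq m : is_pq 1 0 (\sum_k A m k *: dz k).
  by apply: is_pq_sum => k; apply/is_pqZ/dz_pq.
split; first by apply: is_pq_sum => l; apply: is_pqZ; apply: (wedge_pq (pq _) (fconj_pq (pq _))).
exists A => // k l; rewrite sum_ffunE mulr_sumr; apply: eq_bigr => m _.
by rewrite ffunE wedge10_1 // fconj01 !dz_sumE.
Qed.

(* Inverts the normalisation [f = i/2 sum_(k,l) A k l dz_k /\ dzbar_l]. *)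
Definition coefmx f : 'M[C]_n := \matrix_(k, l) (- 2%:R * 'i * f ([set k], [set l])).

Lemma coefmxK f k l : f ([set k], [set l]) = 'i / 2%:R * coefmx f k l.
Proof.
rewrite mxE [RHS](_ : _ = - ('i ^+ 2) * f ([set k], [set l])); first by rewrite sqrCi opprK mul1r.
by field.
Qed.

Lemma kahler_coefmx w : is_kahler w ->
  exists2 A : 'M[C]_n, A \in unitmx & forall k l, coefmx w k l = \sum_m A m k * (A m l)^*.
Proof.
case/kahler_coef => _ [A uA wE]; exists A => // k l; rewrite mxE wE.
rewrite [LHS](_ : _ = - ('i ^+ 2) * (\sum_m A m k * (A m l)^*)); first by rewrite sqrCi opprK mul1r.
by field.
Qed.

(** The value is the squared norm of [A *m x], and [A] is invertible. *)
Lemma kahler_sesq w x : is_kahler w -> (exists k, x k != 0) -> 0 < sesq (coefmx w) x x.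
Proof.
case/kahler_coefmx => A uA wE [k0 x0].
have -> : sesq (coefmx w) x x = \sum_m `|\sum_k A m k * x k| ^+ 2.
  under [RHS]eq_bigr => m _ do rewrite normCK rmorph_sum mulr_suml.
  rewrite exchange_big; apply: eq_bigr => k _ /=.
  under [RHS]eq_bigr => m _ do rewrite mulr_sumr.
  rewrite exchange_big; apply: eq_bigr => l _ /=.
  rewrite wE mulr_sumr mulr_suml; apply: eq_bigr => m _.
  by rewrite rmorphM /=; ring.
have : A *m \col_k x k != 0.
  apply: contraNneq x0 => Ax; have /colP/(_ k0) : \col_k x k = 0.
    by rewrite -[LHS](mulKmx uA) Ax mulmx0.
  by rewrite !mxE => ->.
case/cV0Pn => m; rewrite mxE => Am.
rewrite (bigD1 m) //=; apply: ltr_wpDr; first by apply: sumr_ge0 => l _; rewrite exprn_ge0.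
by rewrite exprn_gt0 // normr_gt0; 
rewrite (eq_bigr (fun k => A m k * (\col_k x k) k 0)) // => k _; rewrite mxE.
Qed.

Lemma griffiths_coefmx (M : 'I_2 -> 'I_2 -> cform n) :
  griffiths_pos2 M -> griffiths (fun i j => coefmx (M i j)).
Proof.
case=> [[_ herm] pos]; split=> [i j k l|th x th0 x0].
  (* The sign from swapping dz and dzbar under conjugation cancels the sign from conjugating
     ['i]. *)
  rewrite !mxE herm fconj11 !rmorphM rmorphN /= rmorph_nat conjCi; ring.
have := kahler_sesq (pos th th0) x0; congr (0 < sesq _ x x).
apply/matrixP => k l; rewrite summxE mxE sum_ffunE mulr_sumr; apply: eq_bigr => i _.
rewrite summxE sum_ffunE mulr_sumr; apply: eq_bigr => j _.
by rewrite !mxE ffunE [_ *: _](erefl : _ = _ * _); ring.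
Qed.

(** The diagonal matrix with entries [w], [w] has determinant [wedge w w], so the positivity results
    for [det2 M] also yield the sign of the top power of [w] in [fstar]. *)
Lemma griffiths_kahler w : is_kahler w ->
  griffiths (fun i j => if i == j then coefmx w else 0).
Proof.
move=> kw; split=> [i j k l|th x [i0 th0] x0].
  rewrite eq_sym; case: eqP => _; last by rewrite !mxE conjC0.
  have [A _ wE] := kahler_coefmx kw; rewrite !wE rmorph_sum.
  by apply: eq_bigr => m _; rewrite rmorphM /= conjCK mulrC.
rewrite sesq_sum2 /= (_ : sesq 0 x x = 0); last first.
  by rewrite /sesq big1 // => k _; rewrite big1 // => l _; rewrite mxE mulr0 mul0r.
rewrite !mulr0 !addr0 -mulrDl -!normCK; apply: mulr_gt0; last exact: kahler_sesq.
have [h|h] : th 0 != 0 \/ th 1 != 0.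
  suff [E|E] : i0 = 0 \/ i0 = 1; [left|right|]; rewrite -?E //.
  by case: i0 {th0} => -[|[|]] // ?; [left|right]; apply/val_inj.
- by apply: ltr_wpDr; rewrite ?exprn_ge0 ?exprn_gt0 ?normr_gt0.
- by apply: ltr_wpDl; rewrite ?exprn_ge0 ?exprn_gt0 ?normr_gt0.
Qed.

(** The factor 1/4 is minus the square of ['i / 2]; the minus sign comes from moving one dzbar past
    one dz. *)
Lemma wedge11_2 f g (i j k l : 'I_n) : is_pq 1 1 f -> (i < j)%N -> (k < l)%N ->
  wedge f g ([set i; j], [set k; l]) = minor2 (coefmx f) (coefmx g) i j k l / 4%:R.
Proof.
move=> fpq ij kl; rewrite wedge11 //=.
have nij : i \notin [set j] by rewrite inE -val_eqE /= ltn_eqF.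
have nkl : k \notin [set l] by rewrite inE -val_eqE /= ltn_eqF.
rewrite !big_setU1 // !big_set1 !big_setU1 // !big_set1 !setU1K //.
have -> : [set i; j] :\ j = [set i] by rewrite setUC setU1K // inE eq_sym -in_set1.
have -> : [set k; l] :\ l = [set k] by rewrite setUC setU1K // inE eq_sym -in_set1.
rewrite /wsign /= !ninv11 !cards1 ij kl !(ltnNge j) !(ltnNge l) (ltnW ij) (ltnW kl) /=.
rewrite !coefmxK.
have : 'i / 2%:R * ('i / 2%:R) = - 4%:R^-1 :> C.
  by rewrite mulrACA -expr2 sqrCi mulN1r -invfM -natrM.
set c := 'i / 2%:R => c2.
transitivity (- (c * c) * minor2 (coefmx f) (coefmx g) i j k l); first by rewrite /minor2; ring.
by rewrite c2 opprK mulrC.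
Qed.

Lemma form_subE f g x : (f - g) x = f x - g x.
Proof. by rewrite !ffunE. Qed.

Lemma det2_coef (M : 'I_2 -> 'I_2 -> cform n) (i j k l : 'I_n) :
  (forall i j, is_pq 1 1 (M i j)) -> (i < j)%N -> (k < l)%N ->
  det2 M ([set i; j], [set k; l]) =
  (minor2 (coefmx (M 0 0)) (coefmx (M 1 1)) i j k l -
   minor2 (coefmx (M 0 1)) (coefmx (M 1 0)) i j k l) / 4%:R.
Proof. by move=> Mpq ij kl; rewrite form_subE !wedge11_2 // -mulrBl. Qed.

End Coefficients.

(** * Coefficients in top and next-to-top degree, and LD *)

Section Top.
Variable n : nat.
Implicit Types (f g w Om : cform n).

Lemma is_pq_ext p q f g : is_pq p q f -> is_pq p q g ->
  (forall x : {set 'I_n} * {set 'I_n}, #|x.1| = p -> #|x.2| = q -> f x = g x) -> f = g.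
Proof.
move=> fpq gpq fg; apply/ffunP => x.
have [[xp xq]|xpq] := eqVneq (#|x.1|, #|x.2|) (p, q); first exact: fg.
by rewrite (is_pq_eq0 fpq) // (is_pq_eq0 gpq).
Qed.

Lemma is_pq0 p q : is_pq p q (0 : cform n).
Proof. by move=> x; rewrite ffunE eqxx. Qed.

Lemma is_pq_big p q f : is_pq p q f -> (n < p)%N || (n < q)%N -> f = 0.
Proof.
move=> fpq npq; apply: (is_pq_ext fpq (is_pq0 p q)) => x xp xq.
have le (A : {set 'I_n}) : (#|A| <= n)%N by rewrite -[leqRHS](card_ord n) max_card.
by move: npq; rewrite -xp -xq !ltnNge !le.
Qed.

Lemma det2_pq (M : 'I_2 -> 'I_2 -> cform n) :
  (forall i j, is_pq 1 1 (M i j)) -> is_pq 2 2 (det2 M).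
Proof.
move=> Mpq x nz; suff: (#|x.1|, #|x.2|) == (2, 2) by case/eqP => -> ->.
apply: contraNT nz => npq; rewrite form_subE.
by rewrite !(is_pq_eq0 (wedge_pq (Mpq _ _) (Mpq _ _)) npq) subr0.
Qed.

Lemma cardsC1_ord (k : 'I_n) : #|[set~ k]| = n.-1.
Proof. by rewrite cardsC1 card_ord. Qed.

Lemma card_ord_setT (A : {set 'I_n}) : #|A| = n -> A = setT.
Proof. by move=> An; apply/eqP; rewrite eqEcard subsetT cardsT An card_ord leqnn. Qed.

(* Up to sign, [u /\ fconj v /\ Om] has top coefficient [u *m hodge_mx Om *m v^*]
   for (1,0)-forms u and v. *)
Definition hodge_mx Om : 'M[C]_n := \matrix_(k, l) ((-1) ^+ (k + l) * Om ([set~ k], [set~ l])).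

(** The global sign comes from moving dzbar_l past the [n.-1] factors dz of [Om]; the other signs
    are absorbed in [hodge_mx]. *)
Lemma wedge11_top f Om : is_pq 1 1 f -> wedge f Om (setT, setT) =
  (-1) ^+ n.-1 * \sum_k \sum_l f ([set k], [set l]) * hodge_mx Om k l.
Proof.
move=> fpq; rewrite wedge11 //= mulr_sumr.
under eq_bigl => k do rewrite inE; apply: eq_bigr => k _; rewrite mulr_sumr.
under eq_bigl => l do rewrite inE; apply: eq_bigr => l _.
by rewrite !setTD /wsign /= !ninv1C cards1 mul1n cardsC1_ord mxE !exprD; ring.
Qed.

(** Wedging with [Om] multiplies the row of coefficients of a (1,0)-form by [hodge_mx Om]; this
    reduces HLT to invertibility of that matrix. For (0,1)-forms the matrix acts on columns
    instead. *)
Lemma wedge10_top f Om (l : 'I_n) : is_pq 1 0 f ->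
  wedge f Om (setT, [set~ l]) =
  (-1) ^+ l * ((\row_k f ([set k], set0)) *m hodge_mx Om) 0 l.
Proof.
move=> fpq; rewrite wedge10 //= mxE mulr_sumr.
under eq_bigl => k do rewrite inE; apply: eq_bigr => k _.
rewrite !setTD /wsign /= ninv1C ninv0l cards0 mul0n !addn0 !mxE exprD.
transitivity (((-1) ^+ l) ^+ 2 * ((-1) ^+ k * f ([set k], set0) * Om ([set~ k], [set~ l]))).
  by rewrite sqrr_sign mul1r.
ring.
Qed.

Lemma wedge01_top f Om (k : 'I_n) : is_pq 0 1 f ->
  wedge f Om ([set~ k], setT) =
  (-1) ^+ n.-1 * (-1) ^+ k * (hodge_mx Om *m (\col_l f (set0, [set l]))) k 0.
Proof.
move=> fpq; rewrite wedge01 //= mxE mulr_sumr.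
under eq_bigl => l do rewrite inE; apply: eq_bigr => l _.
rewrite !setTD /wsign /= ninv1C ninv0l cards1 mul1n cardsC1_ord add0n !mxE !exprD.
transitivity (((-1) ^+ k) ^+ 2 * ((-1) ^+ l * (-1) ^+ n.-1 * f (set0, [set l]) * Om ([set~ k], [set~ l]))).
  by rewrite sqrr_sign mul1r.
ring.
Qed.

(** A row in the left kernel of [G] would be isotropic for the form. *)
Lemma sesq_unitmx (K : numClosedFieldType) (G : 'M[K]_n) :
  (forall x, (exists k, x k != 0) -> 0 < sesq G x x) -> G \in unitmx.
Proof.
move=> Gpos; rewrite -row_free_unit; apply: inj_row_free => v vG.
apply/eqP; apply: contraT => /rV0Pn v0.
suff G0 : sesq G (v 0) (v 0) = 0 by have := Gpos _ v0; rewrite G0 ltxx.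
rewrite /sesq exchange_big big1 // => l _ /=.
by rewrite -mulr_suml; move/rowP/(_ l): vG; rewrite !mxE => ->; rewrite mul0r.
Qed.

Lemma wedge0l f : wedge 0 f = 0.
Proof.
apply/ffunP => x; rewrite wedgeE big1 ?ffunE // => A _; rewrite big1 // => B _.
by rewrite ffunE mulr0 mul0r if_same.
Qed.

Lemma wedge0r f : wedge f 0 = 0.
Proof.
apply/ffunP => x; rewrite wedgeE big1 ?ffunE // => A _; rewrite big1 // => B _.
by rewrite ffunE mulr0 if_same.
Qed.

Lemma fconj0 : fconj (0 : cform n) = 0.
Proof. by apply/ffunP => x; rewrite !ffunE conjC0 mulr0. Qed.

Lemma LD_no_Lpart w Om p q : is_pq 2 2 Om -> is_pq 1 1 w -> (p + q + 2)%N = n ->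
  p = 0%N \/ q = 0%N -> LD w Om p q.
Proof.
move=> Om22 w11 npq pq0.
have L0 b : Lpart w p q b -> b = 0.
  by case=> [//|[p0 [q0 _]]]; case: pq0 => pq0; rewrite pq0 in p0 q0.
have Q0 b c : b = 0 -> Qform w Om p q b c = 0 /\ Qform w Om p q c b = 0.
  by move=> ->; rewrite /Qform fconj0 wedge0r !wedge0l /fstar ffunE mul0r mulr0.
split=> [a apq|]; last by split=> [a /L0|b c /L0 b0 _] //; apply: Q0.
exists 0, a; split; [by left|split; last by rewrite add0r]; split=> //.
(* The bidegree is (p + 3, q + 3). One of [p], [q] is zero and the other is [n - 2], so one entry is
   [n + 1] and the form vanishes. *)
apply: is_pq_big (wedge_pq (wedge_pq apq Om22) w11) _.
by case: pq0 npq => -> <-; rewrite ?addn0 ?add0n !addn1 !leqnn ?orbT.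
Qed.

End Top.

(** * Positivity of the top coefficients and of the Hodge matrix for [n = 2] and [n = 3] *)

Lemma setT2 : [set: 'I_2] = [set ord0; ord_max].
Proof. by apply/setP => -[[|[|]]] // i; rewrite !inE. Qed.

Lemma kahler_top2 (w : cform 2) : is_kahler w -> 0 < fpow w 2 (setT, setT).
Proof.
move=> kw; have [w11 _] := kahler_coef kw.
rewrite /fpow /= wedge1r setT2 wedge11_2 // divr_gt0 ?ltr0n //.
have := griffiths_minor2 (i := ord0) (j := ord_max) (griffiths_kahler kw).
by rewrite /= minor20 subr0; apply.
Qed.

Lemma det2_top2 (M : 'I_2 -> 'I_2 -> cform 2) : griffiths_pos2 M ->
  0 < det2 M (setT, setT).
Proof.
move=> gM; have [[Mpq _] _] := gM; rewrite setT2 det2_coef // divr_gt0 ?ltr0n //.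
exact: griffiths_minor2 (griffiths_coefmx gM) _.
Qed.

Lemma setC1_3 (k : 'I_3) : [set~ k] = [set lift k ord0; lift k ord_max].
Proof. by apply/setP; case: k => -[|[|[|]]] // ? -[[|[|[|]]]] // ?; rewrite !inE. Qed.

(** Phrased through the coefficients of [Om] alone, so that it serves both [det2 M] and
    [wedge w w]. *)
Lemma hodge_mx_minors (Om : cform 3) (N : 'I_2 -> 'I_2 -> 'M[C]_3) :
  (forall i j k l : 'I_3, (i < j)%N -> (k < l)%N -> Om ([set i; j], [set k; l]) =
    (minor2 (N 0 0) (N 1 1) i j k l - minor2 (N 0 1) (N 1 0) i j k l) / 4%:R) ->
  hodge_mx Om = 4%:R^-1 *: (cofmx2 (N 0 0) (N 1 1) - cofmx2 (N 0 1) (N 1 0)).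
Proof.
have lift_lt (k : 'I_3) : (lift k ord0 < lift k ord_max)%N by case: k => -[|[|[|]]].
move=> OmE; apply/matrixP => k l.
by rewrite !mxE !setC1_3 OmE //; ring.
Qed.

Lemma griffiths_hodge_mx (Om : cform 3) (N : 'I_2 -> 'I_2 -> 'M[C]_3) u : griffiths N ->
  (forall i j k l : 'I_3, (i < j)%N -> (k < l)%N -> Om ([set i; j], [set k; l]) =
    (minor2 (N 0 0) (N 1 1) i j k l - minor2 (N 0 1) (N 1 0) i j k l) / 4%:R) ->
  (exists k, u k != 0) -> 0 < sesq (hodge_mx Om) u u.
Proof.
move=> gN /hodge_mx_minors -> u0.
by rewrite sesq_scale mulr_gt0 ?invr_gt0 ?ltr0n // griffiths_cofmx2.
Qed.

Lemma wedge11_top3 (f Om : cform 3) : is_pq 1 1 f -> wedge f Om (setT, setT) =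
  \sum_k \sum_l f ([set k], [set l]) * hodge_mx Om k l.
Proof. by move=> fpq; rewrite wedge11_top // -signr_odd expr0 mul1r. Qed.

(** Expanding the outer factor [w] through its matrix [A] gives ['i / 2] times the sum of the values
    of the Hodge matrix of [wedge w w] at the rows of [A], which are nonzero because [A] is
    invertible. *)
Lemma kahler_top3 (w : cform 3) : is_kahler w ->
  exists2 r : C, 0 < r & fpow w 3 (setT, setT) = 'i / 2%:R * r.
Proof.
move=> kw; have [w11 [A uA wE]] := kahler_coef kw.
pose G := hodge_mx (wedge w w).
have Gpos u : (exists k, u k != 0) -> 0 < sesq G u u.
  apply: (griffiths_hodge_mx (griffiths_kahler kw)) => i j k l ij kl.
  by rewrite wedge11_2 //= minor20 subr0.
exists (\sum_m sesq G (A m) (A m)).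
  have A0 m : exists k, A m k != 0.
    apply/existsP; apply: contraT; rewrite negb_exists => /forallP Am.
    have /matrixP/(_ m m) := mulmxV uA; rewrite !mxE eqxx big1 => [/esym/eqP|k _].
      by rewrite oner_eq0.
    by move: (Am k); rewrite negbK => /eqP ->; rewrite mul0r.
  by rewrite sum3 !addr_gt0 ?Gpos.
rewrite /fpow /= wedge1r wedge11_top3 // -/G /sesq [in RHS]exchange_big mulr_sumr /=.
apply: eq_bigr => k _; rewrite [in RHS]exchange_big mulr_sumr; apply: eq_bigr => l _ /=.
by rewrite wE -mulrA mulr_suml; congr (_ * _); apply: eq_bigr => m _; ring.
Qed.

(** * The hard Lefschetz property in each bidegree *)

Lemma HLT10 (w Om : cform 3) : is_pq 2 2 Om -> hodge_mx Om \in unitmx -> HLT w Om 1 0.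
Proof.
move=> Om22 uG; have pqW (a : cform 3) : is_pq 1 0 a -> is_pq 3 2 (wedge a Om).
  by move/wedge_pq/(_ Om22).
have ext (f g : cform 3) : is_pq 3 2 f -> is_pq 3 2 g ->
    (forall l, f (setT, [set~ l]) = g (setT, [set~ l])) -> f = g.
  move=> fpq gpq fg; apply: is_pq_ext fpq gpq _ => -[I J] /= In Jn.
  rewrite (card_ord_setT In).
  have /eqP/cards1P[l Jl] : #|~: J| = 1%N by rewrite cardsCs setCK Jn card_ord.
  by rewrite -(setCK J) Jl fg.
split=> [a b apq bpq ab|c cpq].
  apply: (is_pq_ext apq bpq) => -[I J] /= /eqP/cards1P[k ->] /eqP; rewrite cards_eq0 => /eqP ->.
  suff /rowP/(_ k) : \row_k a ([set k], set0) = \row_k b ([set k], set0) by rewrite !mxE.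
  apply: (can_inj (mulmxK uG)); apply/rowP => l.
  by apply: (mulfI (negbT (signr_eq0 C l))); rewrite -!wedge10_top // ab.
(* The preimage solves the linear system of [wedge10_top]; the sign [(-1) ^+ l] undoes the one
   there. *)
pose v := (\row_l ((-1) ^+ l * c (setT, [set~ l]))) *m invmx (hodge_mx Om).
have apq : is_pq 1 0 (\sum_k v 0 k *: dz k) by apply: is_pq_sum => k; apply/is_pqZ/dz_pq.
exists (\sum_k v 0 k *: dz k); split=> //; apply: ext => [| |l]; [exact: pqW|exact: cpq|].
rewrite wedge10_top // (_ : \row_k _ = v); last by apply/rowP => k; rewrite mxE dz_sumE.
by rewrite mulmxKV // mxE mulrA -expr2 sqrr_sign mul1r.
Qed.

Lemma HLT01 (w Om : cform 3) : is_pq 2 2 Om -> hodge_mx Om \in unitmx -> HLT w Om 0 1.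
Proof.
move=> Om22 uG; have pqW (a : cform 3) : is_pq 0 1 a -> is_pq 2 3 (wedge a Om).
  by move/wedge_pq/(_ Om22).
have ext (f g : cform 3) : is_pq 2 3 f -> is_pq 2 3 g ->
    (forall l, f ([set~ l], setT) = g ([set~ l], setT)) -> f = g.
  move=> fpq gpq fg; apply: is_pq_ext fpq gpq _ => -[J I] /= Jn In.
  rewrite (card_ord_setT In).
  have /eqP/cards1P[l Jl] : #|~: J| = 1%N by rewrite cardsCs setCK Jn card_ord.
  by rewrite -(setCK J) Jl fg.
split=> [a b apq bpq ab|c cpq].
  apply: (is_pq_ext apq bpq) => -[J I] /= /eqP; rewrite cards_eq0 => /eqP -> /eqP/cards1P[k ->].
  suff /colP/(_ k) : \col_k a (set0, [set k]) = \col_k b (set0, [set k]) by rewrite !mxE.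
  apply: (can_inj (mulKmx uG)); apply/colP => l.
  have /ffunP/(_ ([set~ l], setT)) := ab; rewrite !wedge01_top //.
  by apply: mulfI; rewrite mulf_neq0 ?signr_eq0.
pose v := invmx (hodge_mx Om) *m \col_l ((-1) ^+ 3.-1 * (-1) ^+ l * c ([set~ l], setT)).
(* The (0,1)-form with coefficients [v], obtained as the conjugate of a (1,0)-form with conjugate
   coefficients. *)
pose a := fconj (\sum_k (v k 0)^* *: dz k).
have apq : is_pq 0 1 a by apply/fconj_pq/is_pq_sum => k; apply/is_pqZ/dz_pq.
exists a; split=> //; apply: ext => [| |l]; [exact: pqW|exact: cpq|].
rewrite wedge01_top // (_ : \col_k _ = v); last first.
  by apply/colP => k; rewrite mxE fconj01 dz_sumE conjCK.
by rewrite mulKVmx // mxE mulrA mulrACA -!expr2 !sqrr_sign !mul1r.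
Qed.

Lemma HLT00 (w Om : cform 2) : is_pq 2 2 Om -> Om (setT, setT) != 0 -> HLT w Om 0 0.
Proof.
move=> Om22 Om0; split=> [a b apq bpq ab|c cpq].
  apply: (is_pq_ext apq bpq) => -[I J] /= /eqP; rewrite cards_eq0 => /eqP -> /eqP.
  by rewrite cards_eq0 => /eqP ->; have /ffunP/(_ (setT, setT)) := ab; rewrite !wedge00 // => /(mulIf Om0).
have fone_pq : is_pq 0 0 (fone 2).
  by move=> x; rewrite ffunE; case: (x =P _) => [-> _|_]; rewrite ?eqxx //= cards0.
pose a := (c (setT, setT) / Om (setT, setT)) *: fone 2.
have apq : is_pq 0 0 a by apply: is_pqZ.
exists a; split=> //; apply: (is_pq_ext (wedge_pq apq Om22) cpq) => -[I J] /= I2 J2.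
rewrite (card_ord_setT I2) (card_ord_setT J2) wedge00 // !ffunE eqxx [_ *: _]mulr1 divfK //.
Qed.

(** * The Hodge-Riemann relations in each bidegree *)

Lemma HRR00 (w Om : cform 2) : 0 < Om (setT, setT) -> 0 < fpow w 2 (setT, setT) ->
  HRR w Om 0 0.
Proof.
move=> Om0 w0 a [apq _] a0; rewrite /Qform /fstar subrr expr0z mul1r mul1r.
rewrite wedge00; last exact: (wedge_pq apq (fconj_pq apq)).
rewrite wedge00 // ffunE /= cards0 mul1r -normCK.
have az : a (set0, set0) != 0.
  apply: contraNneq a0 => az; apply/eqP/(is_pq_ext apq (is_pq0 0 0)) => -[I J] /= /eqP.
  by rewrite cards_eq0 => /eqP -> /eqP; rewrite cards_eq0 => /eqP ->; rewrite ffunE.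
by rewrite !(divr_gt0, mulr_gt0) ?exprn_gt0 ?normr_gt0 ?ltr0n ?fact_gt0.
Qed.

Lemma HRR10 (w Om : cform 3) : is_kahler w ->
  (forall u, (exists k, u k != 0) -> 0 < sesq (hodge_mx Om) u u) -> HRR w Om 1 0.
Proof.
move=> kw Gpos a [apq _] a0; have [r r0 wr] := kahler_top3 kw.
pose u k := a ([set k], set0).
have /Gpos : exists k, u k != 0.
  apply/existsP; apply: contraNT a0; rewrite negb_exists => /forallP u0.
  apply/eqP/(is_pq_ext apq (is_pq0 1 0)) => -[I J] /= /eqP/cards1P[k ->] /eqP.
  by rewrite cards_eq0 => /eqP ->; rewrite ffunE; apply/eqP; move: (u0 k); rewrite negbK.
set s := sesq _ _ _ => s0.
rewrite /Qform /fstar wr wedge11_top3; last exact: (wedge_pq apq (fconj_pq apq)).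
rewrite (_ : \sum_k _ = s); last first.
  apply: eq_bigr => k _; apply: eq_bigr => l _.
  by rewrite wedge10_1 // fconj01 /u; ring.
(* The prefactor ['i] cancels the ['i] in the top coefficient of the cube of [w]; 12 is 2 times
   3!. *)
rewrite [ltRHS](_ : _ = 12%:R * s / r); first by rewrite divr_gt0 ?mulr_gt0 ?ltr0n.
rewrite subr0 expr1z expr0 (_ : 3`! = 6)%N //=; field.
by rewrite neq0Ci andbT gt_eqF.
Qed.

Lemma HRR01 (w Om : cform 3) : is_kahler w ->
  (forall u, (exists k, u k != 0) -> 0 < sesq (hodge_mx Om) u u) -> HRR w Om 0 1.
Proof.
move=> kw Gpos a [apq _] a0; have [r r0 wr] := kahler_top3 kw.
pose u k := (a (set0, [set k]))^*.
have /Gpos : exists k, u k != 0.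
  apply/existsP; apply: contraNT a0; rewrite negb_exists => /forallP u0.
  apply/eqP/(is_pq_ext apq (is_pq0 0 1)) => -[I J] /= /eqP.
  rewrite cards_eq0 => /eqP -> /eqP/cards1P[k ->].
  by rewrite ffunE; apply/eqP; move: (u0 k); rewrite negbK conjC_eq0.
set s := sesq _ _ _ => s0.
rewrite /Qform /fstar wr wedge11_top3; last exact: (wedge_pq apq (fconj_pq apq)).
(* Here dzbar precedes dz, whence the minus sign; it is compensated below by the prefactor, the
   inverse of ['i], which is [- 'i]. The conjugate in [u] restores the order of the arguments of
   [sesq]. *)
rewrite (_ : \sum_k _ = - s); last first.
  rewrite /s /sesq -sumrN; apply: eq_bigr => k _; rewrite -sumrN; apply: eq_bigr => l _.
  by rewrite wedge01_1 // fconj10 /u conjCK; ring.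
rewrite [ltRHS](_ : _ = 12%:R * s / r); first by rewrite divr_gt0 ?mulr_gt0 ?ltr0n.
rewrite sub0r exprN1 invCi expr0 (_ : 3`! = 6)%N //=; field.
by rewrite neq0Ci andbT gt_eqF.
Qed.

(** * Assembly of the bidegrees (0,0), (1,0) and (0,1) *)

Theorem theorem1 (n : nat) (M : 'I_2 -> 'I_2 -> cform n) :
  (n = 2%N \/ n = 3%N) ->
  griffiths_pos2 M ->
  forall (w : cform n), is_kahler w ->
  forall p q : nat, (p + q + 2)%N = n ->
    HLT w (det2 M) p q /\ HRR w (det2 M) p q /\ LD w (det2 M) p q.
Proof.
move=> n23 gM w kw p q npq; have [[Mpq _] _] := gM.
have [w11 _] := kahler_coef kw; have Om22 := det2_pq Mpq.
have cases : [\/ [/\ n = 2, p = 0 & q = 0], [/\ n = 3, p = 1 & q = 0] | [/\ n = 3, p = 0 & q = 1]]%N.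
  case: n23 npq => ->; case: p q => [|[|p]] [|[|q]] //; rewrite ?addSn ?addnS // => _.
  - by constructor 1.
  - by constructor 3.
  - by constructor 2.
suff [] : HLT w (det2 M) p q /\ HRR w (det2 M) p q.
  split=> //; split=> //; apply: LD_no_Lpart => //.
  by case: cases => -[_ -> ->]; [left|right|left].
clear n23 npq; have hodge_pos (n3 : n = 3) :
    forall u, (exists k, u k != 0) -> 0 < sesq (hodge_mx (det2 M)) u u.
  subst n => u; apply: (griffiths_hodge_mx (griffiths_coefmx gM)) => i j k l ij kl.
  exact: det2_coef.
(* Positive definiteness gives invertibility of the Hodge matrix in the two cases with [n = 3]; in
   the case [n = 2] the [try] leaves the goal as it is. *)
case: cases => -[n23 -> ->]; try have uG := sesq_unitmx (hodge_pos n23); subst n.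
- have Om0 := det2_top2 gM.
  by split; [apply: HLT00; rewrite // gt_eqF|apply: HRR00 => //; apply: kahler_top2].
- by split; [apply: HLT10|apply: HRR10 => //; apply: hodge_pos].
- by split; [apply: HLT01|apply: HRR01 => //; apply: hodge_pos].
Qed.
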